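(* Let $V$ be a positive definite quadratic space over $\mathbb{Q}$ with symmetric bilinear form $b$, $\varphi(v)=b(v,v)$, and let $L=\mathbb{Z}v_1+\cdots+\mathbb{Z}v_n$ be a lattice with $\mathbb{Q}L=V$, of even rank $n$, with diagonal Gram matrix $\langle a_1,\dots,a_n\rangle$, $a_j$ positive integers, $\gcd(a_1,\dots,a_n)=1$. Let $c\in\mathbb{Z}$, $N\in\mathbb{Z}_{>0}$ with $\gcd(c,N)=1$, $\nu=-\frac{c}{N}(v_1+\cdots+v_n)$, $X=L+\nu$, and let $h\in\mathbb{Q}$ satisfy $h-\sum_{j=1}^n a_j(c/N)^2\in 8(\gcd(N,4)N)^{-1}\mathbb{Z}$. If $2\,\|\,N$ (i.e. $2\mid N$, $4\nmid N$), then \[ b_2(h,\lambda,0)=2=2^{-(\mathrm{ord}_2N-2)}. \]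
   Context: For a prime $p$ let $V_p=V\otimes\mathbb{Q}_p$, $L_p=L\otimes\mathbb{Z}_p$, $X_p=L_p+\nu$, and $\lambda_p$ the characteristic function of $X_p$. For $z\in\mathbb{Q}_p$, $\mathbf{e}_p(z):=e^{-2\pi i y}$ where $y\in\mathbb{Z}[1/p]$ with $z-y\in\mathbb{Z}_p$. Haar measures: $\int_{L_p}dv=1$ on $V_p$ and $\int_{\mathbb{Z}_p}d\sigma=1$ on $\mathbb{Q}_p$. The local density is $b_p(h,\lambda,0):=\int_{\mathbb{Q}_p}\int_{V_p}\mathbf{e}_p(\sigma(\varphi(v)-h))\lambda_p(v)\,dv\,d\sigma$. *)

(* Defs.v *)
From HB Require Import structures.
From mathcomp Require Import all_boot all_order all_algebra.
From mathcomp Require Import generic_quotient ring_quotient sesquilinear.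
From mathcomp Require Import all_classical all_reals all_analysis.
From mathcomp Require Import complex ring lra.

Set Implicit Arguments.
Unset Strict Implicit.
Unset Printing Implicit Defensive.

Import Order.TTheory GRing.Theory Num.Theory.

Local Open Scope classical_set_scope.
Local Open Scope quotient_scope.
Local Open Scope ring_scope.

Section PadicNorm.
Variables (p : nat) (p_pr : prime p).
Implicit Types x y z : rat.

Definition pval x : int :=
  (logn p `|numq x|%N)%:Z - (logn p `|denq x|%N)%:Z.

Definition pnorm x : rat := if x == 0 then 0 else p%:R ^ (- pval x).

Let p_gt0 : 0 < p%:R :> rat. Proof. by rewrite ltr0n prime_gt0. Qed.

Let p_neq0 : p%:R != 0 :> rat. Proof. exact: lt0r_neq0. Qed.

Lemma pval_frac (a b : int) : a != 0 -> b != 0 ->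
  pval (a%:~R / b%:~R) = (logn p `|a|%N)%:Z - (logn p `|b|%N)%:Z.
Proof.
move=> a0 b0; set x := a%:~R / b%:~R.
have b0' : b%:~R != 0 :> rat by rewrite intr_eq0.
have x0 : x != 0 by rewrite mulf_neq0 ?invr_eq0 ?intr_eq0.
have : numq x * b = a * denq x.
  apply: (@intr_inj rat); rewrite !intrM numqE /x.
  by rewrite mulrAC -[_ / _ * _]mulrA mulVf// mulr1.
move=> /(congr1 absz); rewrite !abszM => /(congr1 (logn p)).
rewrite !lognM ?absz_gt0 ?numq_eq0 ?denq_neq0// => e.
apply/eqP; rewrite /pval subr_eq addrAC -subr_eq opprK -!PoszD; apply/eqP.
by rewrite e.
Qed.

Lemma pval_int (a : int) : pval a%:~R = logn p `|a|%N.
Proof. by rewrite /pval numq_int denq_int logn1 subr0. Qed.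

Lemma pnorm0 : pnorm 0 = 0. Proof. by rewrite /pnorm eqxx. Qed.

Lemma pnorm_gt0 x : x != 0 -> 0 < pnorm x.
Proof. by move=> x0; rewrite /pnorm (negPf x0) exprz_gt0. Qed.

Lemma pnorm_ge0 x : 0 <= pnorm x.
Proof. by have [->|/pnorm_gt0/ltW//] := eqVneq x 0; rewrite pnorm0. Qed.

Lemma pnorm_eq0 x : (pnorm x == 0) = (x == 0).
Proof.
have [->|x0] := eqVneq x 0; first by rewrite pnorm0 eqxx.
by rewrite gt_eqF// pnorm_gt0.
Qed.

Lemma pnormM x y : pnorm (x * y) = pnorm x * pnorm y.
Proof.
have [->|x0] := eqVneq x 0; first by rewrite mul0r pnorm0 mul0r.
have [->|y0] := eqVneq y 0; first by rewrite mulr0 pnorm0 mulr0.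
rewrite /pnorm mulf_eq0 (negPf x0) (negPf y0) /= -expfzDr//; congr (_ ^ _).
have nx : numq x != 0 by rewrite numq_eq0.
have ny : numq y != 0 by rewrite numq_eq0.
have -> : x * y = (numq x * numq y)%:~R / (denq x * denq y)%:~R.
  by rewrite !intrM invfM mulrACA !divq_num_den.
rewrite pval_frac ?mulf_neq0 ?denq_neq0// !abszM !lognM ?absz_gt0 ?denq_neq0//.
by rewrite /pval !PoszD -opprD; congr (- _); rewrite opprD addrACA.
Qed.

Lemma pnorm1 : pnorm 1 = 1.
Proof. by rewrite /pnorm oner_eq0 /pval /= !logn1 subrr oppr0 expr0z. Qed.

Lemma pnormN x : pnorm (- x) = pnorm x.
Proof. by rewrite /pnorm oppr_eq0 /pval numqN denqN abszN. Qed.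

Lemma pnorm_int_le1 (a : int) : pnorm a%:~R <= 1.
Proof.
have [->|a0] := eqVneq a 0; first by rewrite pnorm0 ler01.
rewrite /pnorm intr_eq0 (negPf a0) pval_int -exprnN.
by rewrite invf_le1 ?exprn_gt0// exprn_ege1// ler1n prime_gt0.
Qed.

Lemma pnormD_le1 x : pnorm x <= 1 -> pnorm (1 + x) <= 1.
Proof.
have [->|x0] := eqVneq x 0; first by rewrite addr0 pnorm1.
move=> x1; have dx : pnorm (denq x)%:~R = 1.
  apply/eqP; rewrite eq_le pnorm_int_le1 /=.
  have [/eqP pd|pd] := posnP (logn p `|denq x|).
    by rewrite /pnorm intr_eq0 denq_eq0 pval_int (eqP pd).
  have pn : logn p `|numq x| = 0%N.
    apply/eqP; rewrite -leqn0 leqNgt; apply/negP => pn.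
    have := coprime_num_den x; rewrite /coprime => /eqP g1.
    have : (p %| gcdn `|numq x| `|denq x|)%N.
      move: pn pd; rewrite !logn_gt0 !mem_primes dvdn_gcd.
      by move=> /and3P[_ _ ->] /and3P[_ _ ->].
    by rewrite g1 dvdn1 => /eqP p1; move: p_pr; rewrite p1.
  move: x1; rewrite /pnorm (negPf x0) /pval pn add0r opprK.
  by rewrite -exprnP leNgt exprn_egt1 ?ltr1n ?prime_gt1// (gtn_eqF pd).
rewrite -[1 + x]mulr1 -[X in _ * X]dx.
have -> : pnorm ((1 + x) * pnorm (denq x)%:~R) = pnorm ((1 + x) * (denq x)%:~R).
  by rewrite !pnormM dx pnorm1.
by rewrite mulrDl mul1r -numqE -intrD pnorm_int_le1.
Qed.

Lemma pnormD_max x y : pnorm (x + y) <= Num.max (pnorm x) (pnorm y).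
Proof.
wlog xy : x y / pnorm x <= pnorm y => [wh|].
  by have /orP[/wh//|/wh] := le_total (pnorm x) (pnorm y); rewrite addrC maxC.
have [y0|y0] := eqVneq y 0.
  move: xy; rewrite y0 pnorm0 => x0.
  have /eqP: pnorm x = 0 by apply/eqP; rewrite eq_le x0 pnorm_ge0.
  by rewrite pnorm_eq0 => /eqP ->; rewrite addr0 pnorm0 maxxx.
have yp := pnorm_gt0 y0.
have xy1 : pnorm (x / y) <= 1.
  by rewrite -(ler_pM2r yp) -pnormM divfK// mul1r.
rewrite (max_idPr xy) -[x](divfK y0) -[X in _ + X]mul1r -mulrDl pnormM.
by rewrite -[leRHS]mul1r ler_pM2r// addrC pnormD_le1.
Qed.

Lemma pnormD x y : pnorm (x + y) <= pnorm x + pnorm y.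
Proof.
by rewrite (le_trans (pnormD_max _ _))// ge_max lerDl lerDr !pnorm_ge0.
Qed.

Lemma pdistC x y : pnorm (x - y) = pnorm (y - x).
Proof. by rewrite -pnormN opprB. Qed.

Lemma pnormB_dist x y : `|pnorm x - pnorm y| <= pnorm (x - y).
Proof.
rewrite ler_norml lerNl opprB !lerBlDr; apply/andP; split.
  by rewrite pdistC (le_trans _ (pnormD _ _))// subrK.
by rewrite (le_trans _ (pnormD _ _))// subrK.
Qed.

End PadicNorm.

Section Padic.
Variables (p : nat) (p_pr : prime p).
Implicit Types u v w : nat -> rat.
Local Notation pn := (pnorm p).

Definition pcauchy u : Prop := forall e : rat, 0 < e ->
  exists M, forall i j, (M <= i)%N -> (M <= j)%N -> pn (u i - u j) < e.

Definition pnull u : Prop := forall e : rat, 0 < e ->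
  exists M, forall i, (M <= i)%N -> pn (u i) < e.

(* `pcauchyb p_pr` mentions the primality proof so that the closure properties
   below can be attached to it as instances. *)
Definition pcauchyb (_ : prime p) : {pred nat -> rat} := fun u => `[< pcauchy u >].

Lemma pcauchy_bnd u : pcauchy u -> exists2 B, 0 < B & forall i, pn (u i) < B.
Proof.
move=> /(_ 1 ltr01)[M uM].
exists (1 + pn (u M) + \sum_(i < M) pn (u i)).
  rewrite ltr_wpDr ?sumr_ge0// ?ltr_wpDr ?ltr01 ?pnorm_ge0//.
  by move=> i _; exact: pnorm_ge0.
move=> i; have [iM|Mi] := ltnP i M; last first.
  rewrite ltr_wpDr ?sumr_ge0//; first by move=> j _; exact: pnorm_ge0.
  rewrite -[u i](subrK (u M)) (le_lt_trans (pnormD p_pr _ _))// ltrD2r.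
  exact: uM.
rewrite (bigD1 (Ordinal iM))//= addrCA ltr_pwDr//.
rewrite ltr_wpDr ?sumr_ge0// ?ltr_wpDr ?ltr01 ?pnorm_ge0//.
by move=> j _; exact: pnorm_ge0.
Qed.

Lemma pcauchyb_subring : subring_closed (pcauchyb p_pr).
Proof.
split=> [|u v /asboolP cu /asboolP cv|u v /asboolP cu /asboolP cv].
- by apply/asboolP => e e0; exists 0%N => i j _ _; rewrite subrr pnorm0.
- apply/asboolP => e e0; have e2 : 0 < e / 2 by rewrite divr_gt0.
  have [M uM] := cu _ e2; have [N vN] := cv _ e2.
  exists (maxn M N) => i j; rewrite !geq_max => /andP[Mi Ni] /andP[Mj Nj].
  rewrite -[(u - v) i]/(u i - v i) -[(u - v) j]/(u j - v j).
  have -> : u i - v i - (u j - v j) = u i - u j + (v j - v i) by ring.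
  rewrite (le_lt_trans (pnormD p_pr _ _))// [ltRHS]splitr ltrD//.
    exact: uM.
  exact: vN.
- have [B B0 uB] := pcauchy_bnd cu; have [C C0 vC] := pcauchy_bnd cv.
  apply/asboolP => e e0; have e2 : 0 < e / 2 by rewrite divr_gt0.
  have [M uM] := cu _ (divr_gt0 e2 C0); have [N vN] := cv _ (divr_gt0 e2 B0).
  exists (maxn M N) => i j; rewrite !geq_max => /andP[Mi Ni] /andP[Mj Nj].
  rewrite -[(u * v) i]/(u i * v i) -[(u * v) j]/(u j * v j).
  rewrite -[u i * v i](subrK (u i * v j)) -addrA -mulrBr -mulrBl.
  rewrite (le_lt_trans (pnormD p_pr _ _))// !pnormM// [ltRHS]splitr ltrD//.
    rewrite (le_lt_trans (ler_wpM2r (pnorm_ge0 p_pr _) (ltW (uB i))))//.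
    by rewrite mulrC -ltr_pdivlMr// vN.
  rewrite (le_lt_trans (ler_wpM2l (pnorm_ge0 p_pr _) (ltW (vC j))))//.
  by rewrite -ltr_pdivlMr// uM.
Qed.

HB.instance Definition _ :=
  GRing.isSubringClosed.Build (nat -> rat) (pcauchyb p_pr) pcauchyb_subring.

Record cauchy_seq := CauchySeq {
  cseq :> nat -> rat; cseqP : cseq \in pcauchyb p_pr }.

HB.instance Definition _ := [isSub for cseq].
HB.instance Definition _ := [Choice of cauchy_seq by <:].
HB.instance Definition _ := [SubChoice_isSubComNzRing of cauchy_seq by <:].

Definition null_seq : {pred cauchy_seq} := fun s => `[< pnull s >].

Lemma null_seq_ideal : idealr_closed null_seq.
Proof.
split.
- by apply/asboolP => e e0; exists 0%N => i _; rewrite pnorm0.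
- apply/negP => /asboolP /(_ 1 ltr01)[M /(_ M (leqnn M))].
  by rewrite pnorm1 ltxx.
move=> a u v /asboolP nu /asboolP nv; apply/asboolP => e e0.
have [B B0 aB] := pcauchy_bnd (asboolW (cseqP a)).
have e2 : 0 < e / 2 by rewrite divr_gt0.
have [M uM] := nu _ (divr_gt0 e2 B0); have [N vN] := nv _ e2.
exists (maxn M N) => i; rewrite geq_max => /andP[Mi Ni].
rewrite -[cseq _ i]/(a i * u i + v i).
rewrite (le_lt_trans (pnormD p_pr _ _))// [ltRHS]splitr ltrD ?vN//.
rewrite pnormM// (le_lt_trans (ler_wpM2r (pnorm_ge0 p_pr _) (ltW (aB i))))//.
by rewrite mulrC -ltr_pdivlMr// uM.
Qed.

HB.instance Definition _ := isIdealr.Build cauchy_seq null_seq null_seq_ideal.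

(* Q_p as the completion of Q: Cauchy sequences modulo null sequences. *)
Definition padic := {ideal_quot null_seq}.

HB.instance Definition _ := GRing.ComNzRing.on padic.
HB.instance Definition _ := NzRingQuotient.on padic.

Lemma padic_pi_eq0 (s : cauchy_seq) : (\pi_padic s == 0) = (s \in null_seq).
Proof. by rewrite -(pi_zeror (s := padic)) -Quotient.idealrBE subr0. Qed.

Lemma cauchy_seq_stable (s : cauchy_seq) : s \notin null_seq ->
  exists2 c, 0 < c & exists M, forall i, (M <= i)%N -> pn (s i) = c.
Proof.
move=> /asboolPn/existsNP[e /not_implyP[e0 /forallNP sN]].
have [M sM] := asboolW (cseqP s) _ e0.
have /existsNP[k /not_implyP[Mk /negP]] := sN M.
rewrite -leNgt => ek; exists (pn (s k)); first exact: lt_le_trans ek.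
exists M => i Mi.
have le1 x y : pn (x - y) < pn y -> pn x <= pn y.
  move=> xy; rewrite -[x](subrK y) (le_trans (pnormD_max p_pr _ _))//.
  by rewrite ge_max lexx andbT ltW.
have ik : pn (s i - s k) < pn (s k) by rewrite (lt_le_trans _ ek)// sM.
have le_ik := le1 _ _ ik.
apply/eqP; rewrite eq_le le_ik /= leNgt; apply/negP => lt_ik.
have := pnormD_max p_pr (s i) (s k - s i); rewrite addrC subrK.
by rewrite le_max leNgt lt_ik /= pdistC// leNgt ik.
Qed.

Lemma padic_inv_ex (x : padic) : x != 0 -> exists y, y * x = 1.
Proof.
elim/quotW: x => s; rewrite padic_pi_eq0 => /cauchy_seq_stable[c c0 [M sM]].
have s_neq0 i : (M <= i)%N -> s i != 0.
  by move=> Mi; rewrite -(pnorm_eq0 p_pr) sM// gt_eqF.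
have cv : (fun i => (s i)^-1) \in pcauchyb p_pr.
  apply/asboolP => e e0.
  have [N sN] := asboolW (cseqP s) _ (mulr_gt0 (mulr_gt0 c0 c0) e0).
  exists (maxn M N) => i j; rewrite !geq_max => /andP[Mi Ni] /andP[Mj Nj].
  have si := s_neq0 _ Mi; have sj := s_neq0 _ Mj.
  have ci : 0 < pn (s i) * pn (s j) by rewrite !sM// mulr_gt0.
  rewrite -(ltr_pM2l ci) -!pnormM//.
  have -> : s i * s j * ((s i)^-1 - (s j)^-1) = s j - s i.
    by field; rewrite ?si ?sj.
  by rewrite pnormM// !sM// sN.
exists (\pi_padic (CauchySeq cv)).
rewrite -(pi_oner (s := padic)) -pi_mulr; apply/eqP; rewrite -Quotient.idealrBE.
apply/asboolP => e e0; exists M => i Mi.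
rewrite -[cseq _ i]/((s i)^-1 * s i - 1).
by rewrite mulVf ?s_neq0// subrr pnorm0.
Qed.

Definition padic_inv (x : padic) : padic := xget 0 [set y | y * x = 1].

Lemma padic_mulVf x : x != 0 -> padic_inv x * x = 1.
Proof.
by move=> /padic_inv_ex[y yx]; rewrite /padic_inv; case: xgetP => [z -> //|/(_ y)].
Qed.

Lemma padic_inv0 : padic_inv 0 = 0.
Proof.
rewrite /padic_inv; case: xgetP => // z _ /eqP.
by rewrite mulr0 eq_sym oner_eq0.
Qed.

HB.instance Definition _ :=
  GRing.ComNzRing_isField.Build padic padic_mulVf padic_inv0.

Lemma pcauchy_cst (q : rat) : cst q \in pcauchyb p_pr.
Proof. by apply/asboolP => e e0; exists 0%N => i j _ _; rewrite subrr pnorm0. Qed.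

Definition padic_of_rat (q : rat) : padic := \pi_padic (CauchySeq (pcauchy_cst q)).

Lemma padic_of_rat_zmod : zmod_morphism padic_of_rat.
Proof.
move=> x y; rewrite /padic_of_rat -pi_is_zmod_morphism; congr (\pi_padic _).
exact: val_inj.
Qed.

Lemma padic_of_rat_monoid : monoid_morphism padic_of_rat.
Proof.
split; first by rewrite -(pi_oner (s := padic)); congr (\pi_padic _); exact: val_inj.
move=> x y; rewrite /padic_of_rat -pi_mulr; congr (\pi_padic _).
exact: val_inj.
Qed.

HB.instance Definition _ :=
  GRing.isZmodMorphism.Build rat padic padic_of_rat padic_of_rat_zmod.
HB.instance Definition _ :=
  GRing.isMonoidMorphism.Build rat padic padic_of_rat padic_of_rat_monoid.

Definition pnorm_cvg u (r : rat) : Prop := forall e : rat, 0 < e ->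
  exists M, forall i, (M <= i)%N -> `|pn (u i) - r| < e.

Lemma pnorm_cvg_ex (s : cauchy_seq) : exists r, pnorm_cvg s r.
Proof.
have [/asboolP s0|/cauchy_seq_stable[c _ [M sM]]] := boolP (s \in null_seq).
  by exists 0 => e /s0[M sM]; exists M => i /sM; rewrite subr0 ger0_norm ?pnorm_ge0.
by exists c => e e0; exists M => i /sM ->; rewrite subrr normr0.
Qed.

Lemma pnorm_cvgD u v w r1 r2 r : (forall i, pn (w i) <= pn (u i) + pn (v i)) ->
  pnorm_cvg u r1 -> pnorm_cvg v r2 -> pnorm_cvg w r -> r <= r1 + r2.
Proof.
move=> uvw ur vr wr; apply/ler_addgt0Pr => e e0.
have e3 : 0 < e / 3 by rewrite divr_gt0.
have [L uL] := ur _ e3; have [M vM] := vr _ e3; have [N wN] := wr _ e3.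
pose i := maxn L (maxn M N).
have Li : (L <= i)%N by rewrite leq_maxl.
have Mi : (M <= i)%N by rewrite !leq_max leqnn orbT.
have Ni : (N <= i)%N by rewrite !leq_max leqnn !orbT.
move: (uL _ Li) (vM _ Mi) (wN _ Ni) (uvw i).
rewrite !ltr_norml => /andP[_ h1] /andP[_ h2] /andP[h3 _] h4; lra.
Qed.

Lemma pnorm_cvg_uniq u r1 r2 : pnorm_cvg u r1 -> pnorm_cvg u r2 -> r1 = r2.
Proof.
have z : pnorm_cvg (cst 0) 0.
  by move=> e e0; exists 0%N => i _; rewrite /= pnorm0 subrr normr0.
have uu i : pn (u i) <= pn (u i) + pn (cst 0 i) by rewrite pnorm0 addr0.
move=> h1 h2; apply/eqP; rewrite eq_le.
by rewrite -[leRHS]addr0 (pnorm_cvgD uu h2 z h1) -[leRHS]addr0 (pnorm_cvgD uu h1 z h2).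
Qed.

Lemma pnorm_cvg_mod (s t : cauchy_seq) r :
  s = t %[mod padic] -> pnorm_cvg s r -> pnorm_cvg t r.
Proof.
move=> /eqP; rewrite -Quotient.idealrBE => /asboolP st sr e e0.
have e2 : 0 < e / 2 by rewrite divr_gt0.
have [M sM] := sr _ e2; have [N stN] := st _ e2.
exists (maxn M N) => i; rewrite geq_max => /andP[/sM h1 /stN].
rewrite -[cseq _ i]/(s i - t i) pdistC => h2.
have := le_lt_trans (pnormB_dist p_pr _ _) h2.
move: h1; rewrite !ltr_norml => /andP[a b] /andP[c d]; apply/andP; split; lra.
Qed.

Definition padic_norm (x : padic) : rat := xget 0 [set r | pnorm_cvg (repr x) r].

Lemma padic_normP (s : cauchy_seq) : pnorm_cvg s (padic_norm (\pi_padic s)).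
Proof.
have ss : repr (\pi_padic s) = s %[mod padic] by rewrite reprK.
apply: pnorm_cvg_mod ss _; rewrite /padic_norm.
by case: xgetP => [r _ //|h]; have [r /h] := pnorm_cvg_ex (repr (\pi_padic s)).
Qed.

Lemma padic_norm0 : padic_norm 0 = 0.
Proof.
rewrite -(pi_zeror (s := padic)); apply: pnorm_cvg_uniq (padic_normP _) _.
by move=> e e0; exists 0%N => i _; rewrite pnorm0 subrr normr0.
Qed.

Lemma padic_norm_eq0 x : padic_norm x = 0 -> x = 0.
Proof.
elim/quotW: x => s sx; apply/eqP; rewrite padic_pi_eq0; apply/asboolP => e e0.
have := padic_normP s; rewrite sx => /(_ e e0)[M sM]; exists M => i /sM.
by rewrite subr0 ger0_norm ?pnorm_ge0.
Qed.

Lemma padic_normN x : padic_norm (- x) = padic_norm x.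
Proof.
elim/quotW: x => s; rewrite -pi_oppr.
apply: pnorm_cvg_uniq (padic_normP _) _ => e /(padic_normP s)[M sM].
by exists M => i /sM; rewrite -[cseq (- s) i]/(- s i) pnormN.
Qed.

Lemma padic_normD x y : padic_norm (x + y) <= padic_norm x + padic_norm y.
Proof.
elim/quotW: x => s; elim/quotW: y => t; rewrite -pi_addr.
apply: pnorm_cvgD (padic_normP s) (padic_normP t) (padic_normP (s + t)) => i.
exact: pnormD.
Qed.

Definition padic_dist (x y : padic) : rat := padic_norm (x - y).

Lemma padic_distxx x : padic_dist x x = 0.
Proof. by rewrite /padic_dist subrr padic_norm0. Qed.

Lemma padic_dist_eq0 x y : padic_dist x y = 0 -> x = y.
Proof. by move=> /padic_norm_eq0/eqP; rewrite subr_eq0 => /eqP. Qed.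

Lemma padic_distC x y : padic_dist x y = padic_dist y x.
Proof. by rewrite /padic_dist -padic_normN opprB. Qed.

Lemma padic_dist_triangle y x z :
  padic_dist x z <= padic_dist x y + padic_dist y z.
Proof. by rewrite (le_trans _ (padic_normD _ _))// addrA subrK. Qed.

HB.instance Definition _ := isPointed.Build padic 0.
HB.instance Definition _ := isMetric.Build rat padic
  padic_distxx padic_dist_eq0 padic_distC padic_dist_triangle.

Definition padic_int : set padic := [set x | padic_norm x <= 1].

End Padic.

Arguments padic_int {p} p_pr _.

Section Analysis.

Definition borel (T : ptopologicalType) := g_sigma_algebraType (@open T).

HB.instance Definition _ (T : ptopologicalType) := Pointed.on (borel T).
HB.instance Definition _ (T : ptopologicalType) := Measurable.on (borel T).

(* Haar measures of a second countable locally compact abelian group (T, add);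
   in this setting regularity is automatic. *)
Definition is_haar (R : realType) (T : ptopologicalType)
    (mu : {measure set (borel T) -> \bar R}) (add : T -> T -> T) : Prop :=
  [/\ forall (x : T) (A : set (borel T)), measurable A ->
        mu [set add x y | y in A] = mu A,
      forall K : set T, compact K -> (mu K < +oo)%E
    & mu setT != 0%E].

Definition Cintegral d (T : measurableType d) (R : realType)
    (mu : {measure set T -> \bar R}) (f : T -> R[i]) : R[i] :=
  ((\int[mu]_x complex.Re (f x)) +i* (\int[mu]_x complex.Im (f x)))%C.

End Analysis.

Section LocalDensity.
Variables (p : nat) (p_pr : prime p) (R : realType).

Local Notation Qp := (padic p_pr).
Local Notation Zp := (padic_int p_pr).
Local Notation rat_p := (padic_of_rat p_pr).

(* The value does not depend on the representative y of z modulo Z_p. *)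
Definition epadic (z : Qp) : R[i] :=
  let y := xget 0 [set y : rat |
    (exists (m : int) (k : nat), y = m%:~R / p%:R ^+ k) /\ Zp (z - rat_p y)] in
  let t : R := - (2 * pi * ratr y) in (cos t +i* sin t)%C.

Variable V : vectType rat.

(* V (x) Q_p, in coordinates with respect to the Q-basis vbasis {:V}; padic_vec
   is x |-> x (x) 1. *)
Definition padic_space := 'rV[Qp]_(\dim {:V}).

HB.instance Definition _ := GRing.Lmodule.on padic_space.
HB.instance Definition _ := PointedTopological.on padic_space.

Definition padic_vec (x : V) : padic_space :=
  \row_i rat_p (coord (vbasis {:V}) i x).

(* The Q_p-bilinear extension of b. *)
Definition padic_form (b : V -> V -> rat) (x y : padic_space) : Qp :=
  \sum_i \sum_j x 0 i * y 0 j * rat_p (b (vbasis {:V})`_i (vbasis {:V})`_j).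

(* L (x) Z_p, as the Z_p-span of L in V (x) Q_p. *)
Definition padic_lattice (L : set V) : set padic_space :=
  [set x | exists (m : nat) (t : 'I_m -> Qp) (l : 'I_m -> V),
    [/\ forall i, Zp (t i), forall i, L (l i)
      & x = \sum_(i < m) t i *: padic_vec (l i)]].

Definition padic_coset (L : set V) (nu : V) : set padic_space :=
  [set x + padic_vec nu | x in padic_lattice L].

Definition local_density (b : V -> V -> rat) (L : set V) (nu : V)
    (dv : {measure set (borel padic_space) -> \bar R})
    (dsigma : {measure set (borel Qp) -> \bar R}) (h : rat) : R[i] :=
  Cintegral dsigma (fun sigma : Qp =>
    Cintegral dv (fun x : padic_space =>
      epadic (sigma * (padic_form b x x - rat_p h))
      * ((\1_(padic_coset L nu) x : R)%:C)%C)).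

End LocalDensity.

Arguments padic_vec {p} p_pr {V} x.
Arguments padic_lattice {p} p_pr {V} L _.

Definition zlattice (V : vectType rat) (n : nat) (v : n.-tuple V) : set V :=
  [set x | exists z : 'I_n -> int, x = \sum_(i < n) tnth v i *~ z i].

Lemma prime2 : prime 2. Proof. by []. Qed.

(* Main.v *)
(** On the coset X_2 every coordinate is half a 2-adic unit, so phi(v) - h lies
    in 2 Z_2 and the integrand reduces to the indicator of X_2 (of measure 1)
    when sigma is in (1/2) Z_2. Otherwise sigma is congruent modulo Z_2 to
    m / 2^k with m odd and k >= 2; since the a_j have gcd 1 some a_j is odd, and
    translating v by 2^(k-1) v_j moves sigma (phi(v) - h) by an element of
    1/2 + Z_2. This flips the sign of the integrand, and translation invariance
    of the Haar measure makes the inner integral equal to its opposite, hence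
    zero. The density is therefore the measure of (1/2) Z_2, which is the union
    of two translates of Z_2. *)

Require Import Defs.
From HB Require Import structures.
From mathcomp Require Import all_boot all_order all_algebra.
From mathcomp Require Import generic_quotient ring_quotient sesquilinear.
From mathcomp Require Import all_classical all_reals all_analysis.
From mathcomp Require Import complex ring lra zify.

Set Implicit Arguments.
Unset Strict Implicit.
Unset Printing Implicit Defensive.

Import Order.TTheory GRing.Theory Num.Theory.
Local Open Scope classical_set_scope.
Local Open Scope quotient_scope.
Local Open Scope ring_scope.

(** * p-adic integers *)

(** Passes the ultrametric inequality from the terms of a sequence to the limits of their norms, at
    the cost of an error [e]. *)
Lemma approx_le_max (F : realFieldType) (x y z x' y' z' e : F) :
  `|x - x'| < e / 2 -> `|y - y'| < e / 2 -> `|z - z'| < e / 2 ->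
  z <= Num.max x y -> z' <= Num.max x' y' + e.
Proof.
rewrite !ltr_norml => /andP[_ h1] /andP[_ h2] /andP[h3 _].
have h4 : x' <= Num.max x' y' by rewrite le_max lexx.
have h5 : y' <= Num.max x' y' by rewrite le_max lexx orbT.
by rewrite le_max => /orP[] h6; lra.
Qed.

Section PadicIntegers.
Variables (p : nat) (p_pr : prime p).
Local Notation Qp := (padic p_pr).
Local Notation Zp := (padic_int p_pr).
Local Notation rat_p := (padic_of_rat p_pr).
Local Notation norm := (@padic_norm p p_pr).
Implicit Types (x y z : Qp) (s t : cauchy_seq p_pr) (q : rat).

(** Limits are unique, so the norm can be read off any sequence whose terms eventually have constant
    norm; by [cauchy_seq_stable] every nonzero class has this property. *)
Lemma padic_norm_eventually s c :
  (exists M, forall i, (M <= i)%N -> pnorm p (s i) = c) ->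
  norm (\pi_Qp s) = c.
Proof.
move=> [M sM]; apply: pnorm_cvg_uniq (padic_normP s) _ => // e e0.
by exists M => i /sM ->; rewrite subrr normr0.
Qed.

Lemma padic_norm_rat q : norm (rat_p q) = pnorm p q.
Proof. by apply: padic_norm_eventually; exists 0%N. Qed.

(** Null sequences give 0 on both sides. Otherwise both norms are eventually constant, and
    multiplicativity on the rationals applies term by term. *)
Lemma padic_normM x y : norm (x * y) = norm x * norm y.
Proof.
elim/quotW: x => s; elim/quotW: y => t.
have [s0|s0] := boolP (s \in @null_seq p p_pr).
  have /eqP -> : \pi_Qp s == 0 by rewrite padic_pi_eq0.
  by rewrite mul0r padic_norm0 mul0r.
have [t0|t0] := boolP (t \in @null_seq p p_pr).
  have /eqP -> : \pi_Qp t == 0 by rewrite padic_pi_eq0.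
  by rewrite mulr0 padic_norm0 mulr0.
have [c _ [M sM]] := cauchy_seq_stable s0.
have [d _ [M' tM]] := cauchy_seq_stable t0.
rewrite (@padic_norm_eventually s c); last by exists M.
rewrite (@padic_norm_eventually t d); last by exists M'.
rewrite -pi_mulr; apply: padic_norm_eventually.
exists (maxn M M') => i; rewrite geq_max => /andP[/sM si /tM ti].
by rewrite -[cseq _ i]/(s i * t i) pnormM// si ti.
Qed.

Lemma padic_norm_ge0 x : 0 <= norm x.
Proof.
elim/quotW: x => s; rewrite leNgt; apply/negP => n0.
have n1 : 0 < - norm (\pi_Qp s) by rewrite oppr_gt0.
have [M /(_ M (leqnn M))] := padic_normP s n1.
rewrite ltr_norml opprK => /andP[_]; have := pnorm_ge0 p_pr (s M).
by move: n0; move: (norm _) (pnorm _ _) => r r'; clear; lra.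
Qed.

Lemma padic_normD_max x y : norm (x + y) <= Num.max (norm x) (norm y).
Proof.
elim/quotW: x => s; elim/quotW: y => t; rewrite -pi_addr.
apply/ler_addgt0Pr => e e0; have e3 : 0 < e / 2 by rewrite divr_gt0.
have [L sL] := padic_normP s e3; have [M tM] := padic_normP t e3.
have [N stN] := padic_normP (s + t) e3.
pose i := maxn L (maxn M N).
have Li : (L <= i)%N by rewrite leq_maxl.
have Mi : (M <= i)%N by rewrite !leq_max leqnn orbT.
have Ni : (N <= i)%N by rewrite !leq_max leqnn !orbT.
exact: approx_le_max (sL _ Li) (tM _ Mi) (stN _ Ni) (pnormD_max p_pr _ _).
Qed.

Lemma padic_int_rat q : Zp (rat_p q) <-> pnorm p q <= 1.
Proof. by rewrite /padic_int /= padic_norm_rat. Qed.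

Lemma padic_int_int (m : int) : Zp m%:~R.
Proof. by rewrite -(rmorph_int rat_p) padic_int_rat pnorm_int_le1. Qed.

Lemma padic_int_nat (m : nat) : Zp m%:R.
Proof. exact: (padic_int_int m). Qed.

Lemma padic_int0 : Zp 0. Proof. exact: (padic_int_nat 0). Qed.

Lemma padic_int1 : Zp 1. Proof. exact: (padic_int_nat 1). Qed.

Lemma padic_intD x y : Zp x -> Zp y -> Zp (x + y).
Proof.
rewrite /padic_int /= => x1 y1; rewrite (le_trans (padic_normD_max _ _))//.
by rewrite ge_max x1 y1.
Qed.

Lemma padic_intN x : Zp x -> Zp (- x).
Proof. by rewrite /padic_int /= padic_normN. Qed.

Lemma padic_intB x y : Zp x -> Zp y -> Zp (x - y).
Proof. by move=> xZ /padic_intN; exact: padic_intD. Qed.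

Lemma padic_intM x y : Zp x -> Zp y -> Zp (x * y).
Proof.
by rewrite /padic_int /= padic_normM => x1 y1; rewrite mulr_ile1// padic_norm_ge0.
Qed.

Lemma padic_intX x k : Zp x -> Zp (x ^+ k).
Proof.
move=> xZ; elim: k => [|k IHk]; first by rewrite expr0; exact: padic_int1.
by rewrite exprS; exact: padic_intM.
Qed.

Lemma padic_int_sum (I : Type) (r : seq I) (P : pred I) (F : I -> Qp) :
  (forall i, P i -> Zp (F i)) -> Zp (\sum_(i <- r | P i) F i).
Proof. by apply: big_ind; [exact: padic_int0|exact: padic_intD]. Qed.

Lemma pnorm_den_coprime (m : int) (d : nat) : (0 < d)%N -> coprime p d ->
  pnorm p (m%:~R / d%:R) <= 1.
Proof.
move=> d0 pd; have d0' : d%:R != 0 :> rat by rewrite pnatr_eq0 -lt0n.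
have nd : pnorm p d%:R = 1.
  rewrite /pnorm (negPf d0') -[d%:R]/(d%:Z%:~R) pval_int /= lognE p_pr d0 /=.
  by move: pd; rewrite prime_coprime// => /negPf ->; rewrite oppr0 expr0z.
rewrite -[leLHS]mulr1 -[X in _ * X]nd -pnormM// divfK//.
exact: pnorm_int_le1.
Qed.

Lemma padic_int_frac (m : int) (d : nat) : (0 < d)%N -> coprime p d ->
  Zp (rat_p (m%:~R / d%:R)).
Proof. by move=> d0 pd; apply/padic_int_rat/pnorm_den_coprime. Qed.

(** A term of the Cauchy sequence beyond the threshold for 1 serves as [q]. *)
Lemma padic_dense x : exists q, Zp (x - rat_p q).
Proof.
elim/quotW: x => s.
have [M sM] := asboolW (cseqP s) 1 ltr01.
exists (s M); rewrite /padic_int /= -pi_is_zmod_morphism.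
set t := (X in \pi X).
rewrite leNgt; apply/negP => n1.
have n0 : 0 < norm (\pi_Qp t) - 1 by rewrite subr_gt0.
have [L tL] := padic_normP t n0.
have Li : (L <= maxn L M)%N by rewrite leq_maxl.
have Mi : (M <= maxn L M)%N by rewrite leq_maxr.
have := sM _ _ Mi (leqnn M); have := tL _ Li.
rewrite -[cseq t _]/(s (maxn L M) - s M) ltr_norml => /andP[].
by move: n1; move: (norm _) (pnorm _ _) => r r'; clear; lra.
Qed.

(** Partial fractions: a rational approximant is a / (p^k d) with d prime to p, and u p^k + w d = 1
    splits it into a w / p^k + a u / d. The last term lies in Z_p. *)
Lemma padic_approx x :
  exists (m : int) (k : nat), Zp (x - rat_p (m%:~R / p%:R ^+ k)).
Proof.
have [q xq] := padic_dense x.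
pose k := logn p `|denq q|%N.
have dq0 : (0 < `|denq q|)%N by rewrite absz_gt0 denq_neq0.
have [d pd dE] : exists2 d, coprime p d & `|denq q|%N = (p ^ k * d)%N.
  have [d pd dE] := pfactor_coprime p_pr dq0.
  by exists d => //; rewrite {1}dE mulnC.
have d0 : (0 < d)%N by move: dq0; rewrite dE muln_gt0 => /andP[].
have p0 : p%:R != 0 :> rat by rewrite pnatr_eq0 -lt0n prime_gt0.
have d0' : d%:R != 0 :> rat by rewrite pnatr_eq0 -lt0n.
have [a qE] : exists a : int, q = a%:~R / (p%:R ^+ k * d%:R).
  exists (numq q); rewrite -[LHS]divq_num_den; congr (_ / _).
  rewrite -[denq q]gez0_abs ?denq_ge0// dE.
  by rewrite -[_%:~R]/((p ^ k * d)%:R) natrM natrX.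
have : coprimez (p ^ k)%:Z d.
  by rewrite /coprimez /= /gcdz /= eqz_nat; exact: coprimeXl.
move=> /coprimezP[[u w] /= uw].
have uw' : u%:~R * p%:R ^+ k + w%:~R * d%:R = 1 :> rat.
  rewrite -natrX -[(p ^ k)%:R]/((p ^ k)%:Z%:~R) -[d%:R]/(d%:Z%:~R).
  by rewrite -!intrM -intrD uw.
exists (a * w), k.
have -> : x - rat_p ((a * w)%:~R / p%:R ^+ k)
     = (x - rat_p q) + rat_p ((a * u)%:~R / d%:R).
  rewrite -addrA; congr (_ + _); rewrite -!rmorphN -rmorphD; congr (rat_p _).
  have -> : q = a%:~R * (u%:~R * p%:R ^+ k + w%:~R * d%:R) / (p%:R ^+ k * d%:R).
    by rewrite uw' mulr1.
  by rewrite !intrM; field; rewrite d0' expf_neq0.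
by apply: padic_intD => //; exact: padic_int_frac.
Qed.

(** Z[1/p] meets Z_p in Z: norm at most 1 forces p^k to divide [m]. *)
Lemma padic_int_Zinvp (m : int) (k : nat) :
  Zp (rat_p (m%:~R / p%:R ^+ k)) -> exists l : int, m%:~R / p%:R ^+ k = l%:~R :> rat.
Proof.
have p0 : p%:R != 0 :> rat by rewrite pnatr_eq0 -lt0n prime_gt0.
have [->|m0] := eqVneq m 0; first by exists 0; rewrite mul0r.
rewrite padic_int_rat /pnorm mulf_eq0 intr_eq0 (negPf m0) /= invr_eq0.
rewrite expf_eq0 (negPf p0) andbF -natrX -[(p ^ k)%:R]/((p ^ k)%:Z%:~R).
rewrite pval_frac// ?eqz_nat -?lt0n ?expn_gt0 ?prime_gt0// pfactorK// opprB.
have [km _|mk] := leqP k (logn p `|m|).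
  have : ((p ^ k)%:Z %| m)%Z by rewrite dvdzE absz_nat pfactor_dvdn ?absz_gt0.
  move=> /dvdzP[l ->]; exists l.
  by rewrite intrM -[(p ^ k)%:Z%:~R]/((p ^ k)%:R) natrX mulfK ?expf_neq0.
rewrite subzn 1?ltnW// -exprnP leNgt exprn_egt1 ?ltr1n ?prime_gt1//.
by rewrite negbK subn_eq0 leqNgt mk.
Qed.

(** By the ultrametric inequality, the unit ball around a point of Z_p stays in Z_p. *)
Lemma padic_int_open : open Zp.
Proof.
rewrite openE => x xZ; apply/nbhs_ballP; exists 1 => //= y.
rewrite ballEmdist /= /padic_dist => xy; rewrite -[y](subKr x).
by apply: padic_intB => //; exact: ltW.
Qed.

End PadicIntegers.

(** * Integrals and measure-preserving maps *)

Section MeasurePreserving.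
Context d (T : measurableType d) (R : realType).
Import HBNNSimple.

Section Precomposition.
Variables (tau : T -> T) (h : {nnsfun T >-> R}).

(** The proof [mtau] is an argument so that the simple-function structure below can be inferred from
    the term itself. *)
Definition nnsfun_precomp (mtau : measurable_fun setT tau) : T -> R := h \o tau.

Variable mtau : measurable_fun setT tau.

Let precomp_measurable : measurable_fun setT (nnsfun_precomp mtau).
Proof. exact: measurableT_comp. Qed.

Let precomp_fimage : finite_set (range (nnsfun_precomp mtau)).
Proof.
apply: (@sub_finite_set _ _ (range h)); last exact: fimfunP.
by move=> _ [x _ <-]; exists (tau x).
Qed.

Let precomp_ge0 x : 0 <= nnsfun_precomp mtau x.
Proof. exact: fun_ge0. Qed.

HB.instance Definition _ := isMeasurableFun.Build _ _ T R
  (nnsfun_precomp mtau) precomp_measurable.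
HB.instance Definition _ := FiniteImage.Build T R
  (nnsfun_precomp mtau) precomp_fimage.
HB.instance Definition _ := isNonNegFun.Build T R
  (nnsfun_precomp mtau) precomp_ge0.

End Precomposition.

Variables (mu : {measure set T -> \bar R}) (tau : T -> T).
Hypothesis mtau : measurable_fun setT tau.
Hypothesis mu_tau : forall A, measurable A -> mu (tau @^-1` A) = mu A.

(* The integral is a supremum over the simple functions below f, and
   precomposition with tau maps those below f to some below f \o tau. *)
Lemma ge0_le_integral_precomp (f : T -> \bar R) : (forall x, 0 <= f x)%E ->
  (\int[mu]_x f x <= \int[mu]_x f (tau x))%E.
Proof.
move=> f0; rewrite !ge0_integralTE//.
apply: ge_ereal_sup => _ [h /= hf <-].
have -> : sintegral mu h = sintegral mu (nnsfun_precomp h mtau).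
  apply: eq_fsbigr => r _; congr (_ * _)%E.
  by rewrite -[RHS]/(mu (tau @^-1` (h @^-1` [set r]))) mu_tau.
apply: ereal_sup_ubound.
exists [the {nnsfun T >-> R} of nnsfun_precomp h mtau] => //= x.
exact: hf.
Qed.

(** Precomposition with [tau] exchanges the positive and negative parts of [f], so the integral of
    each is bounded by that of the other. *)
Lemma Rintegral_anti_invariant (f : T -> R) :
  (forall x, f (tau x) = - f x) -> \int[mu]_x f x = 0.
Proof.
move=> ftau; rewrite /Rintegral integralE.
set fp := (\int[mu]_x _)%E; set fn := (\int[mu]_x _)%E.
(* If both parts are infinite, the difference is still infinite and [fine] sends it to 0. *)
suff -> : fn = fp by case: fp => [r| |]//=; rewrite subrr.
have fpE : fp = (\int[mu]_x (EFin \o f)^\- (tau x))%E.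
  by apply: eq_integral => x _; rewrite funeposE funenegE/= ftau ?opprK.
have fnE : fn = (\int[mu]_x (EFin \o f)^\+ (tau x))%E.
  by apply: eq_integral => x _; rewrite funeposE funenegE/= ftau ?opprK.
apply/eqP; rewrite eq_le; apply/andP; split.
  by rewrite fpE; apply: ge0_le_integral_precomp => x; exact: funeneg_ge0.
by rewrite fnE; apply: ge0_le_integral_precomp => x; exact: funepos_ge0.
Qed.

Lemma Cintegral_anti_invariant (f : T -> R[i]) :
  (forall x, f (tau x) = - f x) -> Cintegral mu f = 0.
Proof.
move=> ftau; rewrite /Cintegral !Rintegral_anti_invariant// => x;
  by rewrite ftau; case: (f x).
Qed.

End MeasurePreserving.

Lemma Cintegral_indic d (T : measurableType d) (R : realType)
    (mu : {measure set T -> \bar R}) (A : set T) : measurable A ->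
  Cintegral mu (fun x => ((\1_A x : R)%:C)%C) = ((fine (mu A))%:C)%C.
Proof.
move=> mA; rewrite /Cintegral /=; congr (_ +i* _)%C.
  by rewrite /Rintegral integral_indic// setIT.
by rewrite Rintegral_cst // mul0r.
Qed.

(** * Borel sets and translation invariance of Haar measures *)

Section Haar.
Variables (R : realType) (T : ptopologicalType).

Lemma borel_open (U : set (borel T)) : @open T U -> measurable U.
Proof. exact: sub_sigma_algebra. Qed.

Lemma borel_continuous (f : T -> T) : continuous f ->
  measurable_fun setT (f : borel T -> borel T).
Proof.
move=> cf.
apply: (@measurability _ _ (borel T) (borel T) setT f (@open T)) => // _ [U oU <-].
by rewrite setTI; apply: borel_open; move/continuousP: cf; exact.
Qed.

Variables (mu : {measure set (borel T) -> \bar R}) (add : T -> T -> T).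
Hypothesis mu_haar : is_haar mu add.

(** The preimage under translation by [s] is the image under the inverse translation by [t], to
    which invariance applies. *)
Lemma haar_preimage (s t : T) (A : set (borel T)) : cancel (add s) (add t) ->
  cancel (add t) (add s) -> measurable A -> mu (add s @^-1` A) = mu A.
Proof.
move=> st ts mA; have [inv _ _] := mu_haar; rewrite -(inv t A mA); congr (mu _).
apply/seteqP; split=> [x Ax|_ [x Ax <-]] /=; last by rewrite ts.
by exists (add s x) => //; exact: st.
Qed.

End Haar.

(** * Continuity of translations on Q_p and on matrices over Q_p *)

Section PadicTopology.
Variables (p : nat) (p_pr : prime p).
Local Notation Qp := (padic p_pr).

Lemma padic_add_continuous (t : Qp) : continuous (+%R t).
Proof.
move=> x U /nbhs_ballP[e e0 eU]; apply/nbhs_ballP; exists e => // y xy.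
apply: eU; move: xy; rewrite !ballEmdist /= /mdist /= /padic_dist.
by rewrite opprD addrACA subrr add0r.
Qed.

Lemma padic_mx_add_continuous m n (t : 'M[Qp]_(m, n)) : continuous (+%R t).
Proof.
move=> x U [P xP PU]; exists (fun i j => +%R (t i j) @^-1` P i j) => [i j|y yP].
  by apply: padic_add_continuous; have := xP i j; rewrite mxE.
by apply: PU => i j; rewrite mxE; exact: yP.
Qed.

End PadicTopology.

(** * The additive character of Q_2 *)

Section EpadicTwo.
Variable R : realType.
Local Notation Q2 := (padic prime2).
Local Notation Z2 := (padic_int prime2).
Local Notation rat_2 := (padic_of_rat prime2).

Lemma trig_int_pi (x : R) (m : int) :
  cos (x + m%:~R * pi) = (-1) ^+ `|m|%N * cos x /\
  sin (x + m%:~R * pi) = (-1) ^+ `|m|%N * sin x.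
Proof.
have nat_pi (k : nat) (y : R) : cos (y + k%:R * pi) = (-1) ^+ k * cos y /\
    sin (y + k%:R * pi) = (-1) ^+ k * sin y.
  elim: k y => [|k IHk] y; first by rewrite mul0r addr0 !mul1r.
  rewrite -addn1 natrD mulrDl mul1r addrA cosDpi sinDpi.
  by have [-> ->] := IHk y; rewrite exprD expr1 -!mulrA !mulN1r !mulrN.
case: m => k; first exact: nat_pi.
(* For a negative multiple, the natural case is applied at the shifted point, which leads back to
   [x]; the sign is its own inverse. *)
rewrite NegzE abszN absz_nat; have [] := nat_pi k.+1 (x + (- k.+1%:Z)%:~R * pi).
rewrite rmorphN /= mulNr subrK => -> ->.
by rewrite !mulrA -exprD addnn -mul2n exprM sqrrN !expr1n !mul1r.
Qed.

(** Exposes the representative picked by [xget]; [padic_approx] rules out the default value. *)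
Lemma epadic_repr (z : Q2) : exists y : rat,
  [/\ exists (m : int) (k : nat), y = m%:~R / 2%:R ^+ k, Z2 (z - rat_2 y) &
   epadic R z = (cos (- (2 * pi * ratr y)) +i* sin (- (2 * pi * ratr y)))%C].
Proof.
rewrite /epadic; case: xgetP => [y _ [yE zy]|]; first by exists y.
have [m [k zmk]] := padic_approx z.
by move=> /(_ (m%:~R / 2%:R ^+ k)) []; split => //; exists m, k.
Qed.

Lemma half_int_of_padic_int (y : rat) :
  (exists (m : int) (k : nat), y = m%:~R / 2%:R ^+ k) ->
  Z2 (2 * rat_2 y) -> exists m : int, y = m%:~R / 2.
Proof.
move=> [m [k ->]] h; have : Z2 (rat_2 ((2 * m)%:~R / 2%:R ^+ k)).
  by rewrite intrM -mulrA rmorphM /= rmorphMn /= rmorph1.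
move=> /padic_int_Zinvp[l lE]; exists l; rewrite -lE intrM.
by field; exact: expf_neq0.
Qed.

(** The chosen representatives differ by m/2 + l with l an integer, which turns the angle by -(m +
    2l) pi, so only the parity of [m] matters. The case m = 0 gives invariance modulo Z_2, the case
    m = 1 the sign change. *)
Lemma epadicD_half (z w : Q2) (m : int) : Z2 (w - z - rat_2 (m%:~R / 2)) ->
  epadic R w = (-1) ^+ `|m|%N * epadic R z.
Proof.
move=> h.
have [y [[ym [yk yE]] zy ->]] := epadic_repr z.
have [y' [[ym' [yk' yE']] wy ->]] := epadic_repr w.
have d : Z2 (rat_2 (y' - y - m%:~R / 2)).
  rewrite !rmorphB /=.
  have -> : rat_2 y' - rat_2 y - rat_2 (m%:~R / 2) =
    (w - z - rat_2 (m%:~R / 2)) - (w - rat_2 y') + (z - rat_2 y) by ring.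
  by apply: padic_intD => //; exact: padic_intB.
have [l lE] : exists l : int, y' - y - m%:~R / 2 = l%:~R.
  have : exists (a : int) (k : nat), y' - y - m%:~R / 2 = a%:~R / 2%:R ^+ k.
    (* The three fractions over the common denominator 2^(yk' + yk + 1). *)
    exists (ym' * 2 ^+ (yk + 1) - ym * 2 ^+ (yk' + 1) - m * 2 ^+ (yk' + yk)).
    exists (yk' + yk + 1)%N.
    rewrite yE yE' !rmorphB /= !intrM !rmorphXn /= !exprD.
    have a0 : (2 : rat) ^+ yk != 0 by exact: expf_neq0.
    have b0 : (2 : rat) ^+ yk' != 0 by exact: expf_neq0.
    by field; rewrite a0 b0.
  by move=> [a [k aE]]; move: d; rewrite aE => /padic_int_Zinvp.
have yE2 : y' = y + (m + 2 * l)%:~R / 2.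
  by rewrite rmorphD rmorphM /= -lE; field.
have -> : - (2 * pi * ratr y') = - (2 * pi * ratr y) + (- (m + 2 * l))%:~R * pi :> R.
  rewrite yE2 rmorphD /= fmorph_div /= ratr_int rmorphN /= ratr_nat.
  by field.
have [-> ->] := trig_int_pi (- (2 * pi * ratr y)) (- (m + 2 * l)).
have -> : (-1) ^+ `|- (m + 2 * l)|%N = (-1) ^+ `|m|%N :> R.
  rewrite -signr_odd -[RHS]signr_odd; congr (_ ^+ _); congr nat_of_bool; lia.
have <- : (((-1) ^+ `|m|%N : R)%:C)%C = (-1) ^+ `|m|%N :> R[i].
  by rewrite rmorphXn rmorphN1.
by apply/eqP; rewrite eq_complex /= !mul0r subr0 addr0 !eqxx.
Qed.

(** Reduces to z = 0, whose representative is an integer l, so that the angle is -2 pi l. *)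
Lemma epadic_int (z : Q2) : Z2 z -> epadic R z = 1.
Proof.
move=> zZ.
have /(_ 0) := @epadicD_half 0 z; rewrite mul0r rmorph0 !subr0 mul1r => ->//.
have [y [yE]] := epadic_repr 0; rewrite sub0r => /padic_intN; rewrite opprK => yZ ->.
move: yE yZ => [m [k ->]] /padic_int_Zinvp [l ->].
have := trig_int_pi 0 (- (2 * l)); rewrite add0r cos0 sin0 mulr0 mulr1 => -[c s].
have -> : - (2 * pi * ratr l%:~R) = (- (2 * l))%:~R * pi :> R.
  by rewrite ratr_int rmorphN rmorphM /=; ring.
rewrite c s -signr_odd (_ : odd _ = false) //; lia.
Qed.

End EpadicTwo.

(** * V (x) Q_p and its lattices *)

Section PadicSpace.
Variables (p : nat) (p_pr : prime p) (V : vectType rat).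
Local Notation Qp := (padic p_pr).
Local Notation Zp := (padic_int p_pr).
Local Notation rat_p := (padic_of_rat p_pr).
Local Notation Vp := (padic_space p_pr V).
Local Notation vec := (@padic_vec p p_pr V).

Lemma padic_vecD (x y : V) : vec (x + y) = vec x + vec y.
Proof. by apply/rowP => i; rewrite !mxE linearD rmorphD. Qed.

Lemma padic_vecZ (q : rat) (x : V) : vec (q *: x) = rat_p q *: vec x.
Proof. by apply/rowP => i; rewrite !mxE linearZ rmorphM. Qed.

Lemma padic_vec0 : vec 0 = 0.
Proof. by apply/rowP => i; rewrite !mxE linear0 rmorph0. Qed.

Lemma padic_vec_sum (I : Type) (r : seq I) (F : I -> V) :
  vec (\sum_(i <- r) F i) = \sum_(i <- r) vec (F i).
Proof. exact: (big_morph vec padic_vecD padic_vec0). Qed.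

Lemma padic_vec_vbasis (x : Vp) :
  x = \sum_i x 0 i *: vec (vbasis {:V})`_i.
Proof.
apply/rowP => j; rewrite summxE (bigD1 j)//= big1 => [|i ij]; rewrite !mxE.
  by rewrite coord_free ?(basis_free (vbasisP _))// eqxx rmorph1 mulr1 addr0.
by rewrite coord_free ?(basis_free (vbasisP _))// (negPf ij) rmorph0 mulr0.
Qed.

Section Form.
Variable b : {symmetric V}.
Local Notation form := (@padic_form p p_pr V b).

Lemma padic_formDl (x y z : Vp) : form (x + y) z = form x z + form y z.
Proof.
rewrite /padic_form -big_split; apply: eq_bigr => i _ /=.
by rewrite -big_split; apply: eq_bigr => j _ /=; rewrite mxE !mulrDl.
Qed.

Lemma padic_formZl (q : Qp) (x y : Vp) : form (q *: x) y = q * form x y.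
Proof.
rewrite /padic_form mulr_sumr; apply: eq_bigr => i _.
by rewrite mulr_sumr; apply: eq_bigr => j _; rewrite mxE !mulrA.
Qed.

Lemma padic_formC (x y : Vp) : form x y = form y x.
Proof.
rewrite /padic_form exchange_big; apply: eq_bigr => i _; apply: eq_bigr => j _ /=.
(* The sign in [hermC] has exponent 0 for a symmetric form. *)
by rewrite [b _ _]hermC /= expr0 mul1r [x _ _ * _]mulrC.
Qed.

Lemma padic_formDr (x y z : Vp) : form x (y + z) = form x y + form x z.
Proof. by rewrite padic_formC padic_formDl !(padic_formC x). Qed.

Lemma padic_formZr (q : Qp) (x y : Vp) : form x (q *: y) = q * form x y.
Proof. by rewrite padic_formC padic_formZl padic_formC. Qed.

Lemma padic_form_suml (I : Type) (r : seq I) (F : I -> Vp) (y : Vp) :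
  form (\sum_(i <- r) F i) y = \sum_(i <- r) form (F i) y.
Proof.
apply: (big_morph (fun x => form x y) (fun x z => padic_formDl x z y)).
by rewrite -(scale0r 0) padic_formZl mul0r.
Qed.

Lemma padic_form_vec (x y : V) : form (vec x) (vec y) = rat_p (b x y).
Proof.
rewrite {2}(coord_vbasis (memvf x)) {2}(coord_vbasis (memvf y)) /padic_form.
rewrite linear_sumlz rmorph_sum; apply: eq_bigr => i _.
rewrite linear_sumr rmorph_sum; apply: eq_bigr => j _.
by rewrite linearZl_LR linearZr_LR /= !rmorphM !mxE mulrA.
Qed.

End Form.

Section Lattice.
Variables (n : nat) (v : n.-tuple V).
Local Notation Lp := (padic_lattice p_pr (zlattice v)).

(** Expanding each lattice vector in the [v i] and collecting coefficients turns an arbitrary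
    Z_p-combination of elements of L into one of the generators. *)
Lemma padic_latticeP (x : Vp) : Lp x <->
  exists2 t : 'I_n -> Qp, forall i, Zp (t i) & x = \sum_i t i *: vec (tnth v i).
Proof.
split=> [[m [t [l [tZ lL ->]]]]|[t tZ ->]].
  have /choice[z zE] : forall i, exists z : 'I_n -> int,
    l i = \sum_(j < n) tnth v j *~ z j by exact: lL.
  exists (fun j => \sum_(i < m) t i * (z i j)%:~R) => [j|].
    by apply: padic_int_sum => i _; apply: padic_intM => //; exact: padic_int_int.
  under [in RHS]eq_bigr do rewrite scaler_suml.
  rewrite exchange_big; apply: eq_bigr => i _ /=.
  rewrite zE padic_vec_sum scaler_sumr; apply: eq_bigr => j _.
  by rewrite -scaler_int padic_vecZ rmorph_int scalerA.
exists n, t, (tnth v); split => // i; exists (fun j => (j == i)%:Z).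
rewrite (bigD1 i)//= eqxx big1 ?addr0 ?mulr1z// => j ji.
by rewrite (negPf ji) mulr0z.
Qed.

Lemma padic_latticeD (x y : Vp) : Lp x -> Lp y -> Lp (x + y).
Proof.
move=> /padic_latticeP[t tZ ->] /padic_latticeP[s sZ ->].
apply/padic_latticeP; exists (fun i => t i + s i).
  by move=> i; exact: padic_intD.
by rewrite -big_split; apply: eq_bigr => i _; rewrite scalerDl.
Qed.

Lemma padic_near_int_mul (x q : Qp) : \forall y \near x, Zp ((y - x) * q).
Proof.
have q1 : 0 < padic_norm q + 1 by rewrite ltr_wpDl ?padic_norm_ge0.
(* Adding 1 keeps the radius positive when [q] is 0. *)
apply/nbhs_ballP; exists (padic_norm q + 1)^-1; first by rewrite /= invr_gt0.
move=> y; rewrite ballEmdist /= /mdist /= padic_distC /padic_dist => yx.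
rewrite /padic_int /= padic_normM.
apply: le_trans (ler_wpM2r (padic_norm_ge0 q) (ltW yx)) _.
by rewrite ler_pdivrMl// mulr1 lerDl.
Qed.

(** With [q] the change-of-basis matrix from [vbasis] to [v], a vector close enough to [x] differs
    from it by integral coordinates along [v]. *)
Lemma padic_lattice_open : basis_of fullv v -> open Lp.
Proof.
move=> v_basis; rewrite openE => x xL.
pose q i j : rat := coord v j (vbasis {:V})`_i.
exists (fun (_ : 'I_1) i => [set y | forall j, Zp ((y - x 0 i) * rat_p (q i j))]).
  move=> k i; rewrite (ord1 k).
  apply: (@filter_forall Qp _ (fun j y => Zp ((y - x 0 i) * rat_p (q i j)))
    (nbhs (x 0 i)) _) => j.
  exact: padic_near_int_mul.
move=> y yP; rewrite -[y](subrK x); apply: padic_latticeD => //.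
apply/padic_latticeP; exists (fun j => \sum_i (y 0 i - x 0 i) * rat_p (q i j)).
  by move=> j; apply: padic_int_sum => i _; exact: yP.
under [in RHS]eq_bigr do rewrite scaler_suml.
rewrite exchange_big [LHS]padic_vec_vbasis; apply: eq_bigr => i _ /=.
rewrite [in LHS](coord_basis v_basis (memvf (vbasis {:V})`_i)).
rewrite padic_vec_sum scaler_sumr; apply: eq_bigr => j _.
by rewrite padic_vecZ scalerA !mxE (tnth_nth 0).
Qed.

(** As a preimage under a translation, the coset inherits measurability and measure from the
    lattice. *)
Lemma padic_cosetE nu :
  padic_coset (zlattice v) nu = +%R (- vec nu) @^-1` Lp.
Proof.
apply/seteqP; split=> [_ [x xL <-]|x xL] /=; first by rewrite addrC addrK.
by exists (- vec nu + x) => //; rewrite addrC addrA subrr add0r.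
Qed.

End Lattice.

End PadicSpace.

(** * Parity in Z_2 *)

Section TwoAdic.
Local Notation Q2 := (padic prime2).
Local Notation Z2 := (padic_int prime2).
Local Notation rat_2 := (padic_of_rat prime2).

Lemma rat_2_half : 2 * rat_2 (1 / 2) = 1.
Proof. by rewrite -(rmorph_nat rat_2 2) -rmorphM -[RHS](rmorph1 rat_2). Qed.

Lemma half_notin_Z2 : ~ Z2 (rat_2 (1 / 2)).
Proof.
rewrite -[1 / 2]/(1%:~R / 2%:R ^+ 1) => /padic_int_Zinvp[l /eqP].
rewrite expr1 mul1r => /eqP h; have : 1 = (2 * l)%:~R :> rat.
  by rewrite intrM -h mulfV.
move=> /(@intr_inj rat 1); lia.
Qed.

Lemma half_Z2_repr (sigma : Q2) : Z2 (2 * sigma) ->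
  exists m : int, Z2 (sigma - rat_2 (m%:~R / 2)).
Proof.
move=> h; have [m [k mk]] := padic_approx sigma.
have [l lE] : exists l : int, m%:~R / 2%:R ^+ k = l%:~R / 2 :> rat.
  apply: half_int_of_padic_int; first by exists m, k.
  rewrite -[rat_2 _](subKr sigma) mulrBr; apply: padic_intB => //.
  by apply: padic_intM => //; exact: padic_int_nat.
by exists l; rewrite -lE.
Qed.

Lemma half_Z2_split (sigma : Q2) :
  Z2 (2 * sigma) <-> Z2 sigma \/ Z2 (rat_2 (1 / 2) + sigma).
Proof.
have Z22 : Z2 2 by exact: padic_int_nat.
split=> [/half_Z2_repr[m mE]|[h|h]]; last 2 first.
- exact: padic_intM.
- have -> : 2 * sigma = 2 * (rat_2 (1 / 2) + sigma) - 1.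
    by rewrite mulrDr rat_2_half addrC addrA addNr add0r.
  by apply: padic_intB; [exact: padic_intM|exact: padic_int1].
(* The odd case is written 2e - 1 so that 1/2 + m/2 is the integer e. *)
have [e mE'] : exists e : int, m = 2 * e \/ m = 2 * e - 1.
  by exists ((m + 1) %/ 2)%Z; lia.
case: mE' => m2; [left|right].
  rewrite -[sigma](subrK (rat_2 (m%:~R / 2))); apply: padic_intD => //.
  by rewrite m2 intrM mulrC mulKf// rmorph_int; exact: padic_int_int.
have -> : rat_2 (1 / 2) + sigma = (sigma - rat_2 (m%:~R / 2)) + e%:~R.
  have -> : e%:~R = rat_2 (1 / 2) + rat_2 (m%:~R / 2).
    rewrite -(rmorph_int rat_2) -rmorphD; congr (rat_2 _).
    by rewrite m2 intrB intrM; field.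
  by ring.
by apply: padic_intD => //; exact: padic_int_int.
Qed.

(** These are the units of Z_2. *)
Definition odd_Z2 (x : Q2) := exists2 w, Z2 w & x = 1 + 2 * w.

Lemma odd_Z2_Z2 x : odd_Z2 x -> Z2 x.
Proof.
move=> [w wZ ->]; apply: padic_intD; first exact: padic_int1.
by apply: padic_intM => //; exact: padic_int_nat.
Qed.

Lemma odd_Z2M x y : odd_Z2 x -> odd_Z2 y -> odd_Z2 (x * y).
Proof.
move=> [w wZ ->] yo; have yZ := odd_Z2_Z2 yo; have [z zZ ->] := yo.
exists (z + w * (1 + 2 * z)); last by ring.
apply: padic_intD => //; apply: padic_intM => //; apply: odd_Z2_Z2.
by exists z.
Qed.

Lemma odd_Z2D_even x y : odd_Z2 x -> Z2 y -> odd_Z2 (x + 2 * y).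
Proof.
move=> [w wZ ->] yZ; exists (w + y); [exact: padic_intD|by ring].
Qed.

Lemma odd_Z2N x : odd_Z2 x -> odd_Z2 (- x).
Proof.
move=> [w wZ ->]; exists (- 1 - w); last by ring.
by apply: padic_intB => //; apply/padic_intN/padic_int1.
Qed.

Lemma odd_Z2_nat (m : nat) : odd m -> odd_Z2 m%:R.
Proof.
move=> om; exists (m./2)%:R; first exact: padic_int_nat.
by rewrite -[in LHS](odd_double_half m) om natrD -mul2n natrM.
Qed.

Lemma odd_Z2_frac (c : int) (M : nat) : odd `|c|%N -> odd M ->
  odd_Z2 (rat_2 (c%:~R / M%:R)).
Proof.
move=> oc oM; have M0 : M%:R != 0 :> rat by rewrite pnatr_eq0; case: M oM.
pose e : int := ((c - M%:Z) %/ 2)%Z; have ce : c = M%:Z + 2 * e by rewrite /e; lia.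
exists (rat_2 (e%:~R / M%:R)).
  by apply: padic_int_frac; rewrite ?coprime2n//; case: M oM {M0 e ce}.
rewrite -(rmorph_nat rat_2 2) -rmorphM -(rmorph1 rat_2) -rmorphD.
by congr (rat_2 _); rewrite ce intrD intrM; field.
Qed.

(** Apply [half_Z2_split] to t/2. *)
Lemma Z2_parity t : Z2 t -> (exists2 w, Z2 w & t = 2 * w) \/ odd_Z2 t.
Proof.
move=> tZ; pose s := rat_2 (1 / 2) * t.
have st : 2 * s = t by rewrite mulrA rat_2_half mul1r.
have /half_Z2_split[sZ|sZ] : Z2 (2 * s) by rewrite st.
  by left; exists s.
right; exists (rat_2 (1 / 2) + s - 1).
  by apply: padic_intB => //; exact: padic_int1.
rewrite mulrBr mulrDr rat_2_half st; ring.
Qed.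

(** Since [u] is odd, [t] and [t - u] have opposite parities. This serves for (t - r)^2 - r^2 = t (t
    - 2r) with 2r a unit. *)
Lemma mul_sub_odd_even t u : Z2 t -> odd_Z2 u ->
  exists2 w, Z2 w & t * (t - u) = 2 * w.
Proof.
move=> tZ uo; have uZ := odd_Z2_Z2 uo.
case: (Z2_parity tZ) => [[w wZ tE]|[w wZ tE]].
  exists (w * (t - u)); last by rewrite {1}tE mulrA.
  by apply: padic_intM => //; exact: padic_intB.
have [z zZ uE] := uo; exists (t * (w - z)).
  by apply: padic_intM => //; exact: padic_intB.
by rewrite [in X in _ * X]tE uE; ring.
Qed.

(** Cancel factors 2 from a fraction approximating [sigma]: reaching denominator 2 would put
    [2 * sigma] in Z_2, so the numerator becomes odd earlier. *)
Lemma not_half_Z2_repr (sigma : Q2) : ~ Z2 (2 * sigma) ->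
  exists (m : int) (k : nat),
    odd `|m|%N /\ Z2 (sigma - rat_2 (m%:~R / 2 ^+ k.+2)).
Proof.
move=> h; have [m [k mk]] := padic_approx sigma.
(* Expanding the fraction by 2 lets the induction start at denominator 2. *)
have {}mk : Z2 (sigma - rat_2 ((2 * m)%:~R / 2 ^+ k.+1)).
  rewrite (_ : (2 * m)%:~R / 2 ^+ k.+1 = m%:~R / 2%:R ^+ k)//.
  rewrite intrM exprS; have : (2 : rat) ^+ k != 0 by exact: expf_neq0.
  by move=> k0; field.
elim: k (2 * m) mk => [|k IHk] {}m mk.
  case: h; rewrite -[sigma](subrK (rat_2 (m%:~R / 2 ^+ 1))) mulrDr.
  apply: padic_intD; first by apply: padic_intM => //; exact: padic_int_nat.
  rewrite -(rmorph_nat rat_2 2) -rmorphM expr1 mulrC divfK// rmorph_int.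
  exact: padic_int_int.
have [om|em] := boolP (odd `|m|%N); first by exists m, k.
have [q mq] : exists q : int, m = 2 * q by exists (m %/ 2)%Z; lia.
apply: (IHk q).
rewrite (_ : q%:~R / 2 ^+ k.+1 = m%:~R / 2 ^+ k.+2)// mq intrM [in RHS]exprS.
have : (2 : rat) ^+ k.+1 != 0 by exact: expf_neq0.
by move=> k0; field.
Qed.

(** Modulo Z_2 the product is m o / 2, and m o is odd. *)
Lemma half_shift (sigma : Q2) (m : int) (k : nat) (o : Q2) :
  odd `|m|%N -> Z2 (sigma - rat_2 (m%:~R / 2 ^+ k.+2)) -> odd_Z2 o ->
  Z2 (sigma * (2 ^+ k.+1 * o) - rat_2 (1 / 2)).
Proof.
move=> om mk oo; have oZ := odd_Z2_Z2 oo; have [w wZ oE] := oo.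
set eps := sigma - _ in mk.
pose e : int := ((m - 1) %/ 2)%Z; have me : m = 1 + 2 * e by rewrite /e; lia.
have yE : rat_2 (m%:~R / 2 ^+ k.+2) * 2 ^+ k.+1 = rat_2 (1 / 2) + e%:~R.
  rewrite -(rmorph_nat rat_2 2) -rmorphXn -rmorphM -(rmorph_int rat_2) -rmorphD.
  congr (rat_2 _); rewrite me intrD intrM [_ ^+ k.+2]exprS.
  have : (2 : rat) ^+ k.+1 != 0 by exact: expf_neq0.
  by move=> k0; field.
(* Substitute m = 1 + 2e and o = 1 + 2w; the term 1/2 cancels and the rest is visibly integral. *)
have -> : sigma * (2 ^+ k.+1 * o) - rat_2 (1 / 2)
    = w + (e%:~R + eps * 2 ^+ k.+1) * o.
  rewrite -[sigma](subrK (rat_2 (m%:~R / 2 ^+ k.+2))) -/eps mulrA mulrDl yE.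
  rewrite [in LHS]oE [in RHS]oE.
  transitivity ((2 * rat_2 (1 / 2)) * w + (e%:~R + eps * 2 ^+ k.+1) * (1 + 2 * w)).
    by ring.
  by rewrite rat_2_half mul1r.
apply: padic_intD => //; apply: padic_intM => //.
apply: padic_intD; first exact: padic_int_int.
by apply: padic_intM => //; apply: padic_intX; exact: padic_int_nat.
Qed.

End TwoAdic.

(** * The local density *)

Section DiagonalForm.
Variables (p : nat) (p_pr : prime p) (V : vectType rat) (b : {symmetric V}).
Variables (n : nat) (v : n.-tuple V) (a : 'I_n -> nat).
Hypothesis gram : forall i j : 'I_n,
  b (tnth v i) (tnth v j) = if i == j then (a i)%:R else 0.
Local Notation Qp := (padic p_pr).
Local Notation Zp := (padic_int p_pr).
Local Notation rat_p := (padic_of_rat p_pr).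
Local Notation Vp := (padic_space p_pr V).
Local Notation vec := (@padic_vec p p_pr V).
Local Notation form := (@padic_form p p_pr V b).
Implicit Types x : 'I_n -> Qp.

Lemma padic_form_diag_basis x j :
  form (\sum_i x i *: vec (tnth v i)) (vec (tnth v j)) = (a j)%:R * x j.
Proof.
rewrite padic_form_suml (bigD1 j)//= big1 => [|i ij].
  by rewrite padic_formZl padic_form_vec gram eqxx rmorph_nat addr0 mulrC.
by rewrite padic_formZl padic_form_vec gram (negPf ij) rmorph0 mulr0.
Qed.

Lemma padic_form_diag x :
  form (\sum_i x i *: vec (tnth v i)) (\sum_i x i *: vec (tnth v i))
  = \sum_i (a i)%:R * x i ^+ 2.
Proof.
rewrite {1}padic_form_suml; apply: eq_bigr => i _.
by rewrite padic_formZl padic_formC padic_form_diag_basis mulrCA expr2.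
Qed.

Lemma padic_form_diag_shift x j (s : Qp)
    (y := \sum_i x i *: vec (tnth v i)) :
  form (s *: vec (tnth v j) + y) (s *: vec (tnth v j) + y)
  = form y y + s * ((a j)%:R * (2 * x j + s)).
Proof.
rewrite !padic_formDl !padic_formDr !padic_formZl !padic_formZr.
rewrite (padic_formC b _ y) padic_form_diag_basis padic_form_vec gram eqxx.
by rewrite rmorph_nat; ring.
Qed.

Lemma padic_cosetP (q : rat) (y : Vp) :
  padic_coset (zlattice v) (q *: \sum_i tnth v i) y ->
  exists2 t : 'I_n -> Qp, forall i, Zp (t i) &
    y = \sum_i (t i + rat_p q) *: vec (tnth v i).
Proof.
move=> [_ /padic_latticeP[t tZ ->] <-]; exists t => //.
rewrite padic_vecZ padic_vec_sum scaler_sumr -big_split.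
by apply: eq_bigr => i _; rewrite scalerDl.
Qed.

End DiagonalForm.

Lemma odd_coef n (a : 'I_n -> nat) :
  \big[gcdn/0%N]_(i < n) a i = 1%N -> exists j, odd (a j).
Proof.
move=> a1; apply/existsP; rewrite -[[exists _, _]]negbK negb_exists; apply/negP.
move=> /forallP ev; have : (2 %| \big[gcdn/0%N]_(i < n) a i)%N.
  elim/big_ind: _ => // [x y x2 y2|i _]; first by rewrite dvdn_gcd x2 y2.
  by rewrite dvdn2 ev.
by rewrite a1.
Qed.

(** * The integrand and both integrals at 2, for N = 2M with c and M odd *)

Section LocalDensityAtTwo.
Variables (R : realType) (V : vectType rat) (b : {symmetric V}).
Variables (n : nat) (v : n.-tuple V) (a : 'I_n -> nat) (c : int) (M : nat).
Variables (h : rat) (k : int).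
Hypothesis gram : forall i j : 'I_n,
  b (tnth v i) (tnth v j) = if i == j then (a i)%:R else 0.
Hypothesis c_odd : odd `|c|%N.
Hypothesis M_odd : odd M.
Hypothesis hE : h = \sum_(i < n) (a i)%:R * (c%:~R / (2 * M%:R)) ^+ 2
                    + 2 * (k%:~R / M%:R).

Local Notation Q2 := (padic prime2).
Local Notation Z2 := (padic_int prime2).
Local Notation rat_2 := (padic_of_rat prime2).
Local Notation V2 := (padic_space prime2 V).
Local Notation form := (@padic_form 2 prime2 V b).
Local Notation X2 := (padic_coset (zlattice v)
  (- (c%:~R / (2 * M%:R)) *: \sum_i tnth v i) : set V2).

Lemma twice_center : 2 * rat_2 (c%:~R / (2 * M%:R)) = rat_2 (c%:~R / M%:R).
Proof.
rewrite -(rmorph_nat rat_2 2) -rmorphM; congr (rat_2 _).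
have M0 : M%:R != 0 :> rat by rewrite pnatr_eq0; case: M M_odd.
by field.
Qed.

(** With coordinates t_i - r and r = c/(2M), the difference is the sum of a_i t_i (t_i - 2r) minus
    2k/M. Each product is even because 2r = c/M is a unit, and k/M is in Z_2 because M is odd. *)
Lemma form_sub_even (x : V2) : X2 x ->
  exists2 w, Z2 w & form x x - rat_2 h = 2 * w.
Proof.
move=> /padic_cosetP[t tZ ->]; rewrite (padic_form_diag gram) hE.
set r := c%:~R / (2 * M%:R).
have /choice[w wE] i : exists w, Z2 w /\ t i * (t i - 2 * rat_2 r) = 2 * w.
  have [w ? ?] := mul_sub_odd_even (tZ i) (odd_Z2_frac c_odd M_odd).
  by exists w; split; rewrite // twice_center.
exists (\sum_i (a i)%:R * w i - rat_2 (k%:~R / M%:R)).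
  apply: padic_intB.
    apply: padic_int_sum => i _; apply: padic_intM; first exact: padic_int_nat.
    by have [] := wE i.
  by apply: padic_int_frac; rewrite ?coprime2n//; case: M M_odd.
rewrite rmorphD rmorph_sum rmorphM rmorph_nat opprD addrA mulrBr; congr (_ - _).
rewrite mulr_sumr -sumrB; apply: eq_bigr => i _.
rewrite rmorphM rmorphXn rmorph_nat -mulrBr [RHS]mulrCA; congr (_ * _).
by have [_ <-] := wE i; rewrite rmorphN; ring.
Qed.

Lemma integrand_of_half_Z2 (sigma : Q2) : Z2 (2 * sigma) -> forall x : V2,
  epadic R (sigma * (form x x - rat_2 h)) * ((\1_X2 x : R)%:C)%C
  = ((\1_X2 x : R)%:C)%C.
Proof.
move=> sZ x; rewrite indicE; have [/set_mem xX|_] := boolP (x \in _); last first.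
  by rewrite mulr0.
have [w wZ ->] := form_sub_even xX; rewrite epadic_int ?mul1r//.
by rewrite mulrA (mulrC sigma); exact: padic_intM.
Qed.

Lemma coset_shift (s : Q2) j (x : V2) : Z2 s ->
  X2 x -> X2 (s *: padic_vec prime2 (tnth v j) + x).
Proof.
move=> sZ; rewrite !padic_cosetE /= addrCA => xL; apply: padic_latticeD => //.
apply/padic_latticeP; exists (fun i => if i == j then s else 0) => [i|].
  by case: ifP => // _; exact: padic_int0.
rewrite (bigD1 j)//= eqxx big1 ?addr0// => i ij.
by rewrite (negPf ij) scale0r.
Qed.

Lemma integrand_shift (sigma : Q2) (j : 'I_n) : odd (a j) ->
  ~ Z2 (2 * sigma) -> exists s : V2, forall x : V2,
  epadic R (sigma * (form (s + x) (s + x) - rat_2 h)) * ((\1_X2 (s + x) : R)%:C)%C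
  = - (epadic R (sigma * (form x x - rat_2 h)) * ((\1_X2 x : R)%:C)%C).
Proof.
move=> aj /not_half_Z2_repr[m [l [m_odd ml]]].
have Z22 e : Z2 (2 ^+ e) by apply: padic_intX; exact: padic_int_nat.
(* As [sigma] is m/2^(l+2) modulo Z_2, this shift changes the form by 2^(l+1) times a_j (2 x_j +
   2^(l+1)). That factor is odd, since 2 x_j = 2 t_j - c/M. *)
exists (2 ^+ l.+1 *: padic_vec prime2 (tnth v j)) => x; rewrite !indicE.
have [/set_mem xX|/negP xX] := boolP (x \in X2).
  rewrite mem_set; last exact: coset_shift.
  rewrite !mulr1; have [t tZ xE] := padic_cosetP xX.
  rewrite (@epadicD_half _ (sigma * (form x x - rat_2 h)) _ 1) ?mulN1r//.
  rewrite {1 2}xE (padic_form_diag_shift gram) -xE.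
  set o := (a j)%:R * _.
  have -> : sigma * (form x x + 2 ^+ l.+1 * o - rat_2 h)
     - sigma * (form x x - rat_2 h) = sigma * (2 ^+ l.+1 * o) by ring.
  apply: half_shift m_odd ml _; apply: odd_Z2M; first exact: odd_Z2_nat.
  rewrite mulrDr rmorphN mulrN twice_center exprS.
  have -> : 2 * t j - rat_2 (c%:~R / M%:R) + 2 * 2 ^+ l
     = - rat_2 (c%:~R / M%:R) + 2 * (t j + 2 ^+ l) by ring.
  apply: odd_Z2D_even; first by apply/odd_Z2N/odd_Z2_frac.
  exact: padic_intD.
(* Outside the coset both sides vanish: translating back shows that the complement is stable as
   well. *)
rewrite memNset ?mulr0 ?oppr0//.
move=> /(coset_shift j (padic_intN (Z22 l.+1))).
by rewrite (scaleNr (2 ^+ l.+1)) addKr => /mem_set.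
Qed.

Variables (dv : {measure set (borel V2) -> \bar R}).
Variables (dsigma : {measure set (borel Q2) -> \bar R}).
Hypothesis v_basis : basis_of fullv v.
Hypothesis a_odd : exists j, odd (a j).
Hypothesis dv_haar : is_haar dv +%R.
Hypothesis dv_norm : dv (padic_lattice prime2 (zlattice v)) = 1%E.
Hypothesis dsigma_haar : is_haar dsigma +%R.
Hypothesis dsigma_norm : dsigma (padic_int prime2) = 1%E.

Lemma measurable_coset : measurable (X2 : set (borel V2)).
Proof.
apply: borel_open; rewrite padic_cosetE.
move/continuousP: (@padic_mx_add_continuous _ prime2 _ _
  (- padic_vec prime2 (- (c%:~R / (2 * M%:R)) *: \sum_i tnth v i))).
by apply; exact: padic_lattice_open.
Qed.

Lemma measure_coset : dv X2 = 1%E.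
Proof.
rewrite padic_cosetE (haar_preimage dv_haar (addNKr _) (addKr _))//.
by apply: borel_open; exact: padic_lattice_open.
Qed.

Lemma inner_integral (sigma : Q2) :
  Cintegral dv (fun x : V2 =>
    epadic R (sigma * (form x x - rat_2 h)) * ((\1_X2 x : R)%:C)%C)
  = ((\1_[set s | Z2 (2 * s)] sigma : R)%:C)%C.
Proof.
rewrite indicE; have [/set_mem sZ|/negP sZ] := boolP (sigma \in _).
  under [X in Cintegral _ X]eq_fun do rewrite integrand_of_half_Z2//.
  by rewrite Cintegral_indic ?measure_coset//; exact: measurable_coset.
have [j aj] := a_odd.
have [s sE] := integrand_shift aj (fun h => sZ (mem_set h)).
apply: (@Cintegral_anti_invariant _ _ _ dv (+%R s)) => //.
  by apply: borel_continuous; exact: padic_mx_add_continuous.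
by move=> A mA; rewrite (haar_preimage dv_haar (addKr _) (addNKr _)).
Qed.

Let Z2_measurable : measurable (Z2 : set (borel Q2)).
Proof. by apply: borel_open; exact: padic_int_open. Qed.

Let Z2_shift_measurable :
  measurable (+%R (rat_2 (1 / 2)) @^-1` Z2 : set (borel Q2)).
Proof.
rewrite -[X in measurable X]setTI.
by apply: (borel_continuous (@padic_add_continuous _ prime2 _)).
Qed.

Let half_Z2E : [set s | Z2 (2 * s)] = Z2 `|` +%R (rat_2 (1 / 2)) @^-1` Z2.
Proof. by apply/seteqP; split=> s /half_Z2_split. Qed.

Lemma measurable_half_Z2 : measurable ([set s | Z2 (2 * s)] : set (borel Q2)).
Proof. by rewrite half_Z2E; exact: measurableU. Qed.

Lemma measure_half_Z2 : dsigma [set s | Z2 (2 * s)] = 2%:E.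
Proof.
rewrite half_Z2E measureU//; last first.
  (* A common point of the two translates would put 1/2 in Z_2. *)
  apply/seteqP; split=> // s [/= sZ hsZ]; apply: half_notin_Z2.
  by rewrite -[rat_2 _](addrK s); exact: padic_intB.
have shiftE := haar_preimage dsigma_haar (addKr (rat_2 (1 / 2))) (addNKr _)
  Z2_measurable.
by apply: etrans (congr2 adde dsigma_norm (etrans shiftE dsigma_norm)) _.
Qed.

Lemma local_density_at_two : local_density b (zlattice v)
  (- (c%:~R / (2 * M%:R)) *: \sum_i tnth v i) dv dsigma h = 2.
Proof.
rewrite /local_density; under [X in Cintegral _ X]eq_fun do rewrite inner_integral.
rewrite Cintegral_indic; last exact: measurable_half_Z2.
by rewrite measure_half_Z2 /= rmorph_nat.
Qed.

End LocalDensityAtTwo.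

Theorem theorem3p8 (R : realType) (V : vectType rat) (b : {symmetric V})
    (n : nat) (v : n.-tuple V) (a : 'I_n -> nat) (c : int) (N : nat) (h : rat)
    (dv : {measure set (borel (padic_space prime2 V)) -> \bar R})
    (dsigma : {measure set (borel (padic prime2)) -> \bar R})
    (b_posdef : forall x : V, x != 0 -> 0 < b x x)
    (v_basis : basis_of fullv v)
    (n_even : ~~ odd n)
    (gram : forall i j : 'I_n,
       b (tnth v i) (tnth v j) = if i == j then (a i)%:R else 0)
    (a_pos : forall i : 'I_n, (0 < a i)%N)
    (a_gcd : \big[gcdn/0%N]_(i < n) a i = 1%N)
    (N_pos : (0 < N)%N)
    (cN_coprime : coprime `|c|%N N)
    (h_cond : exists k : int,
       h - \sum_(i < n) (a i)%:R * (c%:~R / N%:R) ^+ 2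
       = 8 * ((gcdn N 4)%:R * N%:R)^-1 * k%:~R)
    (N_even : (2 %| N)%N)
    (N_not4 : ~~ (4 %| N)%N)
    (dv_haar : is_haar dv +%R)
    (dv_norm : dv (padic_lattice prime2 (zlattice v)) = 1%E)
    (dsigma_haar : is_haar dsigma +%R)
    (dsigma_norm : dsigma (padic_int prime2) = 1%E) :
  let nu : V := - (c%:~R / N%:R) *: \sum_(i < n) tnth v i in
  local_density b (zlattice v) nu dv dsigma h = 2
  /\ 2 = 2 ^ (- ((logn 2 N)%:Z - 2)) :> R[i].
Proof.
have [M NE] : exists M, N = (2 * M)%N by exists (N %/ 2)%N; lia.
have M_odd : odd M by lia.
have c_odd : odd `|c|%N.
  by move: cN_coprime; rewrite NE coprimeMr coprimen2 => /andP[].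
have M0 : M%:R != 0 :> rat by rewrite pnatr_eq0; case: M M_odd {NE}.
have NR : N%:R = 2 * M%:R :> rat by rewrite NE natrM.
have g2 : gcdn N 4 = 2%N.
  by rewrite NE -(muln_gcdr 2 M 2) (eqP (_ : coprime M 2)) // coprimen2.
split; last first.
  have -> : logn 2 N = 1%N.
    rewrite NE lognM ?(odd_gt0 M_odd)//.
    by rewrite (_ : logn 2 M = 0)%N // lognE /= dvdn2 M_odd andbF.
  by [].
rewrite /= NR; have [k hk] := h_cond.
apply: (@local_density_at_two _ _ _ _ _ a _ _ _ k) => //; last exact: odd_coef.
(* With gcd(N,4) = 2 and N = 2M, the modulus 8/(gcd(N,4) N) equals 2/M. *)
apply/eqP; rewrite addrC -subr_eq -NR; apply/eqP; rewrite hk g2 NR.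
by field.
Qed.
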